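(* Let $p\ge5$ be a prime with $p\not\equiv 1\pmod{12}$. Then for all integers $k,n\ge 0$ with $p\nmid n$, $$p_{1,1}\left(p^{2 k+1} n+\frac{p^{2 k+2}-1}{12}\right) \equiv 0 \pmod 2.$$
   Context: For a partition $\lambda$, $\mathrm{mex}_{1,1}(\lambda)$ is the smallest positive integer that is not a part of $\lambda$; $p_{1,1}(n)$ is the number of partitions $\lambda$ of $n$ with $\mathrm{mex}_{1,1}(\lambda)$ odd. *)

(* Defs.v *)
From mathcomp Require Import all_boot.

Set Implicit Arguments.
Unset Strict Implicit.
Unset Printing Implicit Defensive.

Definition is_intpart (n : nat) (s : seq nat) : bool :=
  [&& sorted geq s, 0 \notin s & sumn s == n].

Lemma leq_mem_sumn (s : seq nat) (x : nat) : x \in s -> x <= sumn s.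
Proof.
elim: s => //= y s IH; rewrite inE => /predU1P[->|/IH h]; first exact: leq_addr.
exact: leq_trans h (leq_addl _ _).
Qed.

Lemma mex11_subproof (s : seq nat) : exists m, (0 < m) && (m \notin s).
Proof.
exists (sumn s).+1 => /=.
by apply/negP => /leq_mem_sumn; rewrite ltnn.
Qed.

Definition mex11 (s : seq nat) : nat := ex_minn (mex11_subproof s).

(* A partition of n has at most n parts, each at most n, so all of them live
   in the finite type n.-bseq 'I_n.+1 (see intpart_bseq below). *)
Definition p11 (n : nat) : nat :=
  #|[set l : n.-bseq 'I_n.+1 |
      is_intpart n (map val l) && odd (mex11 (map val l))]|.

Lemma intpart_bseq (n : nat) (s : seq nat) :
  is_intpart n s -> exists! l : n.-bseq 'I_n.+1, map val l = s.
Proof.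
case/and3P=> _ s0 /eqP sn.
have szs : size s <= n.
  rewrite -{}sn; elim: s s0 => //= x s IH.
  rewrite inE negb_or eq_sym -lt0n => /andP[x0 /IH h].
  by rewrite -add1n leq_add.
have szl : size (map (@inord n) s) <= n by rewrite size_map.
have E : map val (map (@inord n) s) = s.
  rewrite -map_comp map_id_in // => x xs /=; rewrite inordK // ltnS -sn.
  exact: leq_mem_sumn.
exists (Bseq szl); split=> // l El; apply: val_inj => /=.
by apply: (inj_map val_inj); rewrite El E.
Qed.

Lemma dvd12_primeX (p k : nat) :
  prime p -> 5 <= p -> 12 %| p ^ (2 * k + 2) - 1.
Proof.
move=> pp p5.
have p2 : p ^ 2 %% 12 = 1.
  have n2 : p %% 2 != 0.
    by rewrite -/(dvdn 2 p) dvdn_prime2 //; case: eqP p5 => // <-.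
  have n3 : p %% 3 != 0.
    by rewrite -/(dvdn 3 p) dvdn_prime2 //; case: eqP p5 => // <-.
  rewrite -modnXm; move: n2 n3.
  rewrite -(@modn_dvdm 12 p 2) // -(@modn_dvdm 12 p 3) //.
  have : p %% 12 < 12 by rewrite ltn_mod.
  by move: (p %% 12); do 12!case=> //.
rewrite -eqn_mod_dvd ?expn_gt0 ?(ltnW (prime_gt1 pp)) //.
have -> : 2 * k + 2 = 2 * k.+1 by rewrite mulnS addnC.
by rewrite expnM -modnXm p2 exp1n.
Qed.

(* Main.v *)
(* The alternating sum of the indicators of [j < mex] is 1 exactly when the mex
   is odd, so modulo 2 the generating function P of p11 satisfies
   P * A = T, with A = prod (1 - x^i) and T the sum of x^(j(j+1)/2), j >= 0.
   Let Q = prod (1 - x^(2i-1)) and E = prod (1 - x^(2i)). Then Q * E = A,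
   Gauss's identity reads Q * T = E, and E = A^2 modulo 2; hence
   E * P = A * (A * P) = Q * E * T = E * E, so P = E. By Euler's pentagonal
   theorem at x^2, p11 N is even unless 12 N + 1 is a square. For the N of the
   theorem, 12 N + 1 = p^(2k+1) (12 n + p) has odd p-adic valuation. *)

Require Import Defs.
From mathcomp Require Import all_boot all_algebra.
From mathcomp Require Import ring zify.

Set Implicit Arguments.
Unset Strict Implicit.
Unset Printing Implicit Defensive.

Import GRing.Theory.

(** * Shanks's finite forms of the identities of Euler and Gauss *)

Section FiniteIdentities.

Local Open Scope ring_scope.

Variable R : comNzRingType.
Implicit Types x y : R.

Definition tri (n : nat) : nat := 'C(n.+1, 2).

Lemma triS n : tri n.+1 = (tri n + n.+1)%N.
Proof. by rewrite /tri binS bin1. Qed.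

Lemma tri_double n : (2 * tri n = n * n.+1)%N.
Proof. by elim: n => // n IHn; rewrite triS; lia. Qed.

(** For [m <= n], the quotient (x;x)_n / (x;x)_m of q-Pochhammer symbols, formed without
    division. *)
Definition euler_prod x m n : R := \prod_(m <= i < n) (1 - x ^+ i.+1).

Definition odd_prod x n : R := \prod_(i < n) (1 - x ^+ (2 * i).+1).

Lemma euler_prod_recr x m n : (m <= n)%N ->
  euler_prod x m n.+1 = euler_prod x m n * (1 - x ^+ n.+1).
Proof. by move=> mn; rewrite /euler_prod big_nat_recr. Qed.

Lemma euler_prod_recl x m n : (m < n)%N ->
  euler_prod x m n = (1 - x ^+ m.+1) * euler_prod x m.+1 n.
Proof. by move=> mn; rewrite /euler_prod big_ltn. Qed.

Lemma euler_prodnn x n : euler_prod x n n = 1.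
Proof. by rewrite /euler_prod big_geq. Qed.

Lemma odd_prod0 x : odd_prod x 0 = 1.
Proof. by rewrite /odd_prod big_ord0. Qed.

Lemma odd_prodS x n : odd_prod x n.+1 = odd_prod x n * (1 - x ^+ (2 * n).+1).
Proof. by rewrite /odd_prod big_ord_recr. Qed.

Lemma odd_even_prod x n :
  odd_prod x n * euler_prod (x ^+ 2) 0 n = euler_prod x 0 (2 * n).
Proof.
elim: n => [|n IHn]; first by rewrite odd_prod0 mul1r !euler_prodnn.
rewrite (_ : 2 * n.+1 = (2 * n).+2)%N; last by lia.
rewrite odd_prodS !euler_prod_recr // -IHn -exprM.
by rewrite (_ : 2 * n.+1 = (2 * n).+2)%N; [ring | lia].
Qed.

(* The finite identities of D. Shanks for the pentagonal numbers (here) and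
   for the triangular numbers ([shanks_gauss] below); the term [s = 0] is the
   product side, and the other terms vanish to high order in [x]. *)
Definition shanks_pent x n : R :=
  \sum_(s < n.+1) (-1) ^+ s * x ^+ (s * n + tri s) * euler_prod x s n.

(** Allowing every cut-off [m] makes induction on [m] possible. At [m = n] the boundary term is a
    signed power of [x], because [euler_prod x n n = 1]. *)
Lemma shanks_pent_telescope x n m : (m <= n)%N ->
  \sum_(s < m.+1) (-1) ^+ s * x ^+ (s * n.+1 + tri s) * euler_prod x s n.+1 =
  \sum_(s < m.+1) (-1) ^+ s * x ^+ (s * n + tri s) * euler_prod x s n
  + (-1) ^+ m.+1 * x ^+ (m.+1 * n.+1 + tri m) * euler_prod x m n.
Proof.
elim: m => [_|m IHm lt_mn].
  rewrite !big_ord1 /= !euler_prod_recr // !mul0n !add0n mul1n !addn0.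
  rewrite expr0 expr1.
  by rewrite (_ : tri 0 = 0%N) //; ring.
rewrite big_ord_recr [X in _ = X + _]big_ord_recr /= IHm; last exact: ltnW.
rewrite (euler_prod_recl _ lt_mn) euler_prod_recr // triS.
rewrite (_ : m.+2 * n.+1 + (tri m + m.+1) =
             (m.+1 * n + tri m) + m.+1 + m.+1 + n.+1)%N; last by lia.
rewrite (_ : m.+1 * n.+1 + (tri m + m.+1) =
             (m.+1 * n + tri m) + m.+1 + m.+1)%N; last by lia.
rewrite (_ : m.+1 * n.+1 + tri m = (m.+1 * n + tri m) + m.+1)%N; last by lia.
rewrite (_ : m.+1 * n + (tri m + m.+1) = (m.+1 * n + tri m) + m.+1)%N;
  last by lia.
by rewrite !exprD !exprS; ring.
Qed.

(** With k = i + 1 the exponents are the pentagonal numbers k(3k-1)/2 and k(3k+1)/2. Passing from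
    [n] to [n.+1] yields the first from the telescoping boundary term and the second from the new
    summand [s = n.+1]. *)
Lemma shanks_pentE x n :
  shanks_pent x n = 1 + \sum_(i < n) (-1) ^+ i.+1 *
     (x ^+ (i.+1 * i.+1 + tri i) + x ^+ (i.+1 * i.+1 + tri i.+1)).
Proof.
elim: n => [|n IHn].
  by rewrite /shanks_pent big_ord1 big_ord0 euler_prodnn !expr0 addr0 !mul1r.
rewrite big_ord_recr addrA -IHn /shanks_pent big_ord_recr.
rewrite shanks_pent_telescope //= !euler_prodnn; ring.
Qed.

Lemma shanks_gauss_telescope x n m : (m <= n)%N ->
  \sum_(s < m.+1)
     x ^+ (s * (2 * n.+1).+1) * euler_prod (x ^+ 2) s n.+1 * odd_prod x s =
  (1 - x ^+ (2 * n).+1) * \sum_(s < m.+1)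
     x ^+ (s * (2 * n).+1) * euler_prod (x ^+ 2) s n * odd_prod x s
  + x ^+ (m.+1 * (2 * n).+1) * euler_prod (x ^+ 2) m n * odd_prod x m.+1.
Proof.
elim: m => [_|m IHm lt_mn].
  rewrite !big_ord1 /= !euler_prod_recr // !mul0n mul1n odd_prodS odd_prod0.
  rewrite -exprM muln0 (_ : 2 * n.+1 = (2 * n).+1 + 1)%N; last by lia.
  by rewrite exprD; ring.
rewrite big_ord_recr [X in _ = _ * X + _]big_ord_recr /= IHm; last exact: ltnW.
rewrite (euler_prod_recl _ lt_mn) euler_prod_recr //.
rewrite (odd_prodS x m.+1) -!exprM.
rewrite (_ : m.+1 * (2 * n.+1).+1 = m.+1 * (2 * n).+1 + 2 * m.+1)%N;
  last by lia.
rewrite (_ : m.+2 * (2 * n).+1 = m.+1 * (2 * n).+1 + (2 * n).+1)%N; last by lia.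
rewrite (_ : 2 * n.+1 = (2 * n).+1 + 1)%N; last by lia.
rewrite (_ : (2 * m.+1).+1 = 2 * m.+1 + 1)%N; last by lia.
by rewrite !exprD; ring.
Qed.

(** Each step in [n] adds two triangular exponents: [tri (2 * n)] comes from the summand [s = n],
    which the sum for [n] omits, and [tri (2 * n).+1] from the boundary term. *)
Lemma shanks_gauss x n :
  \sum_(s < n) x ^+ (s * (2 * n).+1) * euler_prod (x ^+ 2) s n * odd_prod x s =
  odd_prod x n * \sum_(s < 2 * n) x ^+ tri s.
Proof.
elim: n => [|n IHn]; first by rewrite !big_ord0 mulr0.
rewrite shanks_gauss_telescope // big_ord_recr /= mulrDr IHn.
rewrite (_ : 2 * n.+1 = (2 * n).+2)%N; last by lia.
rewrite !big_ord_recr /= !euler_prodnn odd_prodS.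
have -> : tri (2 * n).+1 = (n.+1 * (2 * n).+1)%N.
  by have := tri_double (2 * n).+1; lia.
have -> : tri (2 * n) = (n * (2 * n).+1)%N by have := tri_double (2 * n); lia.
ring.
Qed.

(** * Congruence modulo a ring element, and truncated series *)

Definition eqm (d x y : R) : Prop := exists c, x = y + d * c.

Lemma eqm_refl d x : eqm d x x.
Proof. by exists 0; rewrite mulr0 addr0. Qed.

Lemma eqm_sym d x y : eqm d x y -> eqm d y x.
Proof. by case=> c ->; exists (- c); ring. Qed.

Lemma eqm_trans d y x z : eqm d x y -> eqm d y z -> eqm d x z.
Proof. by case=> c -> [e ->]; exists (e + c); ring. Qed.

Lemma eqmD d x x' y y' : eqm d x x' -> eqm d y y' -> eqm d (x + y) (x' + y').
Proof. by case=> c -> [e ->]; exists (c + e); ring. Qed.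

Lemma eqmM d x x' y y' : eqm d x x' -> eqm d y y' -> eqm d (x * y) (x' * y').
Proof.
by case=> c -> [e ->]; exists (c * y' + x' * e + d * c * e); ring.
Qed.

Lemma eqm_cancel d u v x y :
  eqm d (u * v) 1 -> eqm d (u * x) (u * y) -> eqm d x y.
Proof.
move=> uv1 uxy; have uvK z : eqm d (v * (u * z)) z.
  by rewrite mulrA (mulrC v) -[X in eqm _ _ X]mul1r; apply/eqmM/eqm_refl.
apply: eqm_trans (eqm_sym (uvK x)) _; apply: eqm_trans (uvK y).
exact/eqmM/uxy/eqm_refl.
Qed.

Lemma eqm_sum d (I : Type) (r : seq I) (P : pred I) (F G : I -> R) :
  (forall i, P i -> eqm d (F i) (G i)) ->
  eqm d (\sum_(i <- r | P i) F i) (\sum_(i <- r | P i) G i).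
Proof.
move=> FG; elim/big_rec2: _ => [|i y z Pi yz]; first exact: eqm_refl.
by apply: eqmD => //; apply: FG.
Qed.

Lemma eqm_sum0 d (I : Type) (r : seq I) (P : pred I) (F : I -> R) :
  (forall i, P i -> eqm d (F i) 0) -> eqm d (\sum_(i <- r | P i) F i) 0.
Proof.
move=> F0; have /eqm_trans := eqm_sum (G := fun=> 0) r F0.
by apply; rewrite big1 //; apply: eqm_refl.
Qed.

Lemma eqm_prod d (I : Type) (r : seq I) (P : pred I) (F G : I -> R) :
  (forall i, P i -> eqm d (F i) (G i)) ->
  eqm d (\prod_(i <- r | P i) F i) (\prod_(i <- r | P i) G i).
Proof.
move=> FG; elim/big_rec2: _ => [|i y z Pi yz]; first exact: eqm_refl.
by apply: eqmM => //; apply: FG.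
Qed.

Lemma eqm_exp_leq m n x y z : (m <= n)%N ->
  eqm (x ^+ n) y z -> eqm (x ^+ m) y z.
Proof.
by move=> /subnKC <- [c ->]; exists (x ^+ (n - m) * c); rewrite exprD mulrA.
Qed.

Lemma eqm_exp0 m n x y : (m <= n)%N -> eqm (x ^+ m) (x ^+ n * y) 0.
Proof.
by move=> /subnKC <-; exists (x ^+ (n - m) * y); rewrite exprD add0r mulrA.
Qed.

Lemma euler_prod_eqm_widen x m n : (m <= n)%N ->
  eqm (x ^+ m) (euler_prod x 0 n) (euler_prod x 0 m).
Proof.
move=> /subnKC <-; elim: (n - m)%N => [|d IHd].
  by rewrite addn0; apply: eqm_refl.
rewrite addnS euler_prod_recr // -[X in eqm _ _ X]mulr1; apply: eqmM => //.
by exists (- x ^+ d.+1); rewrite -addnS exprD mulrN.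
Qed.

Lemma euler_prod_eqm_pent x n :
  eqm (x ^+ n.+1) (euler_prod x 0 n) (shanks_pent x n).
Proof.
apply: eqm_sym; rewrite /shanks_pent big_ord_recl /= mul0n !expr0 !mul1r.
rewrite -[X in eqm _ _ X]addr0; apply: eqmD; first exact: eqm_refl.
(* The summand of index t = s + 1 has exponent t n + [tri t], which is at least n + 1. *)
apply: eqm_sum0 => s _ /=; rewrite /bump /= mulrAC mulrC.
by apply: eqm_exp0; rewrite add1n triS; lia.
Qed.

Lemma euler_prod_eqm_gauss x n : (0 < n)%N ->
  eqm (x ^+ n) (odd_prod x n * \sum_(s < 2 * n) x ^+ tri s)
               (euler_prod (x ^+ 2) 0 n).
Proof.
case: n => // n _.
rewrite -shanks_gauss big_ord_recl /= odd_prod0 mul0n mul1r mulr1.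
rewrite -[X in eqm _ _ X]addr0; apply: eqmD; first exact: eqm_refl.
apply: eqm_sum0 => s _ /=; rewrite -mulrA.
by apply: eqm_exp0; rewrite /bump /=; lia.
Qed.

End FiniteIdentities.

(** * Series of partitions with mex above a given bound *)

Section MexSeries.

Local Open Scope ring_scope.

Lemma coef_eqm (R : comNzRingType) (n i : nat) (p q : {poly R}) :
  (i < n)%N -> eqm 'X^n p q -> p`_i = q`_i.
Proof. by move=> lt_in [c ->]; rewrite coefD coefXnM lt_in addr0. Qed.

(* A partition is encoded by the multiplicities [m] of its parts [i.+1]; the
   side condition says that each of [1, ..., j] occurs, i.e. that the mex
   exceeds [j]. *)
Definition mex_gt_poly (R : comNzRingType) (n j : nat) : {poly R} :=
  \prod_(i < n) \sum_(m < n | (i < j)%N ==> (0 < m)%N) 'X^(i.+1) ^+ m.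

(** A truncated geometric series; when [b] holds, the missing constant term changes the numerator of
    1/(1-y) from 1 to y. *)
Lemma geom_eqm (R : comNzRingType) (n : nat) (y : R) (b : bool) : (0 < n)%N ->
  eqm (y ^+ n) ((1 - y) * \sum_(m < n | b ==> (0 < m)%N) y ^+ m) (y ^+ b).
Proof.
case: n => // n _; rewrite big_mkcond big_ord_recl /=.
under eq_bigr do rewrite /bump /= implybT.
have geom : (1 - y) * (\sum_(i < n) y ^+ i.+1) = y - y ^+ n.+1.
  elim: n => [|n IHn]; first by rewrite big_ord0; ring.
  by rewrite big_ord_recr /= mulrDr IHn !exprS; ring.
by exists (-1); rewrite mulrDr geom; case: b => /=; ring.
Qed.

Lemma tri_sum (n j : nat) : (j <= n)%N ->
  (\sum_(i < n) (i < j) * i.+1 = tri j)%N.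
Proof.
elim: n j => [|n IHn] j; first by rewrite leqn0 => /eqP->; rewrite big_ord0.
rewrite big_ord_recr /= leq_eqVlt => /predU1P[->|lt_jn].
  rewrite ltnSn mul1n triS -(IHn n) //; congr (_ + _)%N.
  by apply: eq_bigr => i _; rewrite ltn_ord ltnW // ltnS ltn_ord.
by rewrite ltnNge -ltnS lt_jn mul0n addn0 IHn.
Qed.

(** Forcing one copy of each part 1, ..., j costs the exponent 1 + ... + j; the Euler product
    cancels the free choice of the other copies. *)
Lemma mex_gt_poly_eqm (R : comNzRingType) (n j : nat) :
  (0 < n)%N -> (j <= n)%N ->
  eqm ('X^n : {poly R}) (euler_prod 'X 0 n * mex_gt_poly R n j) 'X^(tri j).
Proof.
move=> n_gt0 le_jn.
rewrite /euler_prod big_mkord -big_split /= -(tri_sum le_jn).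
rewrite -prodrXr; apply: eqm_prod => i _.
(* The factor for part [i.+1] is controlled modulo ['X^(i.+1 * n)], a multiple of ['X^n]. *)
rewrite mulnC exprM; apply: (@eqm_exp_leq _ _ (i.+1 * n)).
  exact: leq_pmull.
by rewrite exprM; apply: geom_eqm.
Qed.

End MexSeries.

(** * Partitions as multiplicity functions *)

Section Multiplicities.

Variable n : nat.
Implicit Types (s : seq nat) (f : {ffun 'I_n.+1 -> 'I_n.+1}).

(** Index [i] stands for the part [i.+1]. The range includes [n.+1], absent from partitions of [n],
    to match [mex_gt_poly R n.+1], whose truncation keeps the coefficient of ['X^n]. *)
Definition mults s : {ffun 'I_n.+1 -> 'I_n.+1} :=
  [ffun i : 'I_n.+1 => inord (count_mem i.+1 s)].

Definition weight f : nat := \sum_(i < n.+1) i.+1 * f i.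

Definition has_upto (j : nat) f : bool :=
  [forall i : 'I_n.+1, (i < j) ==> (0 < f i)].

Lemma sumn_count_mem s : (forall x, x \in s -> 0 < x <= n.+1) ->
  sumn s = \sum_(i < n.+1) i.+1 * count_mem i.+1 s.
Proof.
elim: s => [|x s IHs] s_bnd; first by rewrite big1 // => i _; rewrite muln0.
have /andP[x_gt0 x_len] := s_bnd x (mem_head _ _).
rewrite /= IHs => [|y ys]; last by apply: s_bnd; rewrite inE ys orbT.
under [RHS]eq_bigr do rewrite mulnDr.
rewrite [RHS]big_split; congr (_ + _).
have lt_x : x.-1 < n.+1 by lia.
rewrite (bigD1 (Ordinal lt_x)) //= prednK // eqxx muln1 big1 ?addn0 // => i.
rewrite -val_eqE /= => ne_ix.
by rewrite (_ : (x == i.+1) = false) ?muln0 //; apply/eqP; lia.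
Qed.

Lemma intpart_count s x : is_intpart n s -> count_mem x s <= n.
Proof.
move=> /intpart_bseq[l [<- _]]; apply: leq_trans (count_size _ _) _.
by rewrite size_map size_bseq.
Qed.

Lemma intpart_bound s x : is_intpart n s -> x \in s -> 0 < x <= n.+1.
Proof.
case/and3P=> _ s0 /eqP <- xs; rewrite (leqW (leq_mem_sumn xs)) andbT lt0n.
by apply: contraNneq s0 => <-.
Qed.

Lemma multsE s (i : 'I_n.+1) :
  is_intpart n s -> mults s i = count_mem i.+1 s :> nat.
Proof. by move=> s_part; rewrite ffunE inordK // ltnS intpart_count. Qed.

Lemma weight_mults s : is_intpart n s -> weight (mults s) = n.
Proof.
move=> s_part; have /and3P[_ _ /eqP sum_s] := s_part.
rewrite -[RHS]sum_s sumn_count_mem => [|x]; last exact: intpart_bound.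
by apply: eq_bigr => i _; rewrite multsE.
Qed.

Lemma mults_inj s t :
  is_intpart n s -> is_intpart n t -> mults s = mults t -> s = t.
Proof.
move=> s_part t_part eq_st.
have /and3P[s_sorted s0 _] := s_part; have /and3P[t_sorted t0 _] := t_part.
apply: sorted_eq s_sorted t_sorted _.
- by move=> x y z /= yx xz; apply: leq_trans xz yx.
- by move=> x y /andP[xy yx]; apply/eqP; rewrite eqn_leq; apply/andP.
apply/allP => x; rewrite mem_cat => x_st /=; apply/eqP.
have /andP[x_gt0 x_len] : 0 < x <= n.+1.
  by case/orP: x_st; apply: intpart_bound.
have lt_x : x.-1 < n.+1 by lia.
have := multsE (Ordinal lt_x) s_part; have := multsE (Ordinal lt_x) t_part.
by rewrite eq_st /= prednK // => -> ->.
Qed.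

Lemma mults_surj f : weight f = n -> exists2 s, is_intpart n s & mults s = f.
Proof.
move=> wf.
pose u := flatten [seq nseq (f i) i.+1 | i : 'I_n.+1 <- enum 'I_n.+1].
have count_u (i : 'I_n.+1) : count_mem i.+1 u = f i.
  rewrite count_flatten -map_comp sumnE big_map big_enum /=.
  rewrite (bigD1 i) //= count_nseq /= eqxx mul1n big1 ?addn0 // => k ne_ki.
  by rewrite count_nseq /= eqSS val_eqE (negbTE ne_ki).
have u_bnd x : x \in u -> 0 < x <= n.+1.
  by case/flattenP=> t /mapP[i _ ->] /nseqP[-> _] /=; apply: ltn_ord.
have s_part : is_intpart n (sort geq u).
  apply/and3P; split.
  - by apply: sort_sorted => x y /=; apply: leq_total.
  - by rewrite mem_sort; apply/negP => /u_bnd.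
  - rewrite (perm_sumn (permEl (perm_sort _ _))) sumn_count_mem //.
    rewrite -[X in _ == X]wf.
    by apply/eqP; apply: eq_bigr => i _; rewrite count_u.
exists (sort geq u) => //; apply/ffunP => i; apply: val_inj.
by rewrite /= multsE // (permP (permEl (perm_sort _ _))) count_u.
Qed.

Lemma mex11_gt s j : (j < mex11 s) = all (mem s) (iota 1 j).
Proof.
rewrite /mex11; case: ex_minnP => m /andP[m_gt0 m_s] m_min.
apply/idP/allP => [lt_jm x|js].
  rewrite mem_iota add1n => /andP[x_gt0 x_j] /=; apply/negPn/negP => x_s.
  by have := m_min x; rewrite x_gt0 x_s => /(_ isT); lia.
rewrite ltnNge; apply/negP => le_mj; move/negP: m_s; apply.
by apply: js; rewrite mem_iota add1n m_gt0.
Qed.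

Lemma has_upto_mults s j : is_intpart n s -> j <= n.+1 ->
  has_upto j (mults s) = (j < mex11 s).
Proof.
move=> s_part le_jn; rewrite mex11_gt; apply/forallP/allP => [js x|js i].
  rewrite mem_iota add1n ltnS => /andP[x_gt0 x_j].
  have lt_x : x.-1 < n.+1 by lia.
  have := js (Ordinal lt_x); rewrite multsE // /= prednK //= x_j /=.
  by rewrite -has_count has_pred1.
apply/implyP => lt_ij; rewrite multsE // -has_count has_pred1.
by apply: js; rewrite mem_iota; lia.
Qed.

Lemma mex11_le s : mex11 s <= (sumn s).+1.
Proof.
rewrite /mex11; case: ex_minnP => m _; apply => /=.
by apply/negP => /leq_mem_sumn; rewrite ltnn.
Qed.

(** A number m counts the j < m, and the mex is at most [n.+1]. This plain sum has the parity of the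
    alternating one. *)
Lemma mex11_sum s : is_intpart n s ->
  mex11 s = \sum_(j < n.+1) has_upto j (mults s).
Proof.
move=> s_part.
under eq_bigr => j _ do rewrite (has_upto_mults s_part (ltnW (ltn_ord j))).
have /and3P[_ _ /eqP sum_s] := s_part; have := mex11_le s; rewrite sum_s.
move: (mex11 s) n.+1 => m k; elim: k m => [|k IHk] m.
  by rewrite leqn0 big_ord0 => /eqP.
rewrite leq_eqVlt => /predU1P[->|lt_mk].
  rewrite big_ord_recr /= ltnSn addn1 {1}(IHk k) //; congr _.+1.
  by apply: eq_bigr => i _; rewrite ltn_ord ltnW // ltnS ltn_ord.
by rewrite big_ord_recr /= ltnNge -ltnS lt_mk addn0 -IHk.
Qed.

(** Reindexing along [mults], a bijection by [mults_inj] and [mults_surj]. *)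
Lemma sum_intpart (V : nmodType) (F : {ffun 'I_n.+1 -> 'I_n.+1} -> V) :
  (\sum_(l : n.-bseq 'I_n.+1 | is_intpart n (map val l)) F (mults (map val l)) =
   \sum_(f | weight f == n) F f)%R.
Proof.
pose A := [set l : n.-bseq 'I_n.+1 | is_intpart n (map val l)].
pose h (l : n.-bseq 'I_n.+1) := mults (map val l).
have h_inj : {in A &, injective h}.
  move=> l l'; rewrite !inE => l_part l'_part /mults_inj eq_ll'.
  by apply/val_inj/(inj_map val_inj)/eq_ll'.
transitivity (\sum_(f in h @: A) F f)%R.
  by rewrite (big_imset _ h_inj); apply: eq_bigl => l; rewrite inE.
apply: eq_bigl => f; apply/imsetP/eqP => [[l]|/mults_surj[s s_part <-]].
  by rewrite inE => l_part ->; apply: weight_mults.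
by have [l [l_s _]] := intpart_bseq s_part; exists l; rewrite ?inE /h l_s.
Qed.

End Multiplicities.

(** * Generating function of [p11] modulo 2 *)

Section Parity.

Local Open Scope ring_scope.

(** Expanding the product, a choice [f] of multiplicities gives ['X^(weight f)], or 0 as soon as a
    forced part is missing. *)
Lemma coef_mex_gt_poly (R : comNzRingType) (n j : nat) :
  (mex_gt_poly R n.+1 j)`_n =
  \sum_(f : {ffun 'I_n.+1 -> 'I_n.+1} | weight f == n) (has_upto j f)%:R.
Proof.
rewrite /mex_gt_poly; under eq_bigr do rewrite big_mkcond /=.
rewrite bigA_distr_bigA coef_sum [RHS]big_mkcond /=; apply: eq_bigr => f _.
have [upto|/forallPn[i not_upto]] := boolP (has_upto j f).
  under eq_bigr => i _ do rewrite (forallP upto i) -exprM.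
  by rewrite prodrXr coefXn eq_sym; case: eqP.
by rewrite (bigD1 i) //= (negbTE not_upto) mul0r coef0 if_same.
Qed.

Lemma natr_odd_F2 (m : nat) : (odd m)%:R = m%:R :> 'F_2.
Proof.
rewrite -[in RHS](odd_double_half m) natrD -muln2 natrM.
by rewrite (pchar_Fp_0 (isT : prime 2)) mulr0 addr0.
Qed.

(** In ['F_2] the indicator of an odd mex is the mex itself, which [mex11_sum] splits over [j]. *)
Lemma p11_coef (n : nat) :
  (p11 n)%:R = (\sum_(j < n.+1) mex_gt_poly 'F_2 n.+1 j)`_n.
Proof.
rewrite coef_sum; under eq_bigr do rewrite coef_mex_gt_poly.
rewrite exchange_big -(sum_intpart (fun f => \sum_(j < n.+1) (has_upto j f)%:R)).
rewrite /p11 cardsE -sum1_card natr_sum big_mkcondr /=.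
apply: eq_bigr => l l_part; rewrite -natr_sum -mex11_sum // -natr_odd_F2.
by case: odd.
Qed.

Lemma euler_prod_sqr_F2 (x : {poly 'F_2}) (n : nat) :
  euler_prod (x ^+ 2) 0 n = euler_prod x 0 n ^+ 2.
Proof.
have char2 : 2 \in [pchar {poly 'F_2}] by rewrite pchar_poly pchar_Fp.
rewrite /euler_prod -prodrXl; apply: eq_bigr => i _.
rewrite -exprM mulnC exprM; move: (x ^+ _) => y.
rewrite !(oppr_pchar2 char2) sqrrD mul1r expr1n mulr2n.
by rewrite (addrr_pchar2 char2) addr0.
Qed.

Lemma mex_series_eqm (n : nat) :
  eqm ('X^(n.+1) : {poly 'F_2}) (\sum_(j < n.+1) mex_gt_poly 'F_2 n.+1 j)
      (euler_prod ('X ^+ 2) 0 n.+1).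
Proof.
set d := 'X^(n.+1); set P := \sum_(j < _) _; set E := euler_prod _ _ _.
pose A := euler_prod ('X : {poly 'F_2}) 0 n.+1.
pose Q := odd_prod ('X : {poly 'F_2}) n.+1.
pose T : {poly 'F_2} := \sum_(s < 2 * n.+1) 'X^(tri s).
(* With no part forced, [G] counts all partitions and inverts [A]; hence [G * G] inverts
   [E = A ^+ 2]. *)
pose G := mex_gt_poly 'F_2 n.+1 0.
have AG : eqm d (A * G) 1 by apply: mex_gt_poly_eqm.
have AP : eqm d (A * P) T.
  rewrite /T mul2n -addnn big_split_ord /= -[A * P]addr0 mulr_sumr.
  apply: eqmD; first by apply: eqm_sum => j _; apply/mex_gt_poly_eqm/ltnW.
  (* The second half of [T] has exponents [tri (n.+1 + s) >= n.+1]. *)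
  apply/eqm_sym/eqm_sum0 => s _; rewrite -['X^_]mulr1; apply: eqm_exp0.
  by rewrite addSn triS; lia.
have QT : eqm d (Q * T) E by apply: euler_prod_eqm_gauss.
have QE : eqm d (Q * E) A.
  by rewrite odd_even_prod; apply: euler_prod_eqm_widen; lia.
have EA : E = A ^+ 2 by apply: euler_prod_sqr_F2.
apply: (@eqm_cancel _ d E (G * G)).
  rewrite EA (_ : A ^+ 2 * (G * G) = A * G * (A * G)); last by ring.
  by rewrite -[X in eqm _ _ X]mulr1; apply: eqmM.
apply: (@eqm_trans _ _ (Q * E * (A * P))).
  rewrite (_ : E * P = A * (A * P)); last by rewrite EA expr2 mulrA.
  by apply/eqm_sym/eqmM => //; apply: eqm_refl.
apply: (@eqm_trans _ _ (E * (Q * T))).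
  rewrite (_ : E * (Q * T) = Q * E * T); last by rewrite mulrCA mulrA.
  by apply: eqmM => //; apply: eqm_refl.
by apply: eqmM => //; apply: eqm_refl.
Qed.

Lemma p11_even_nonsquare (n : nat) :
  (forall m, 12 * n + 1 <> m ^ 2)%N -> ~~ odd (p11 n).
Proof.
move=> nsq; rewrite -dvdn2 (dvdn_pcharf (pchar_Fp (isT : prime 2))) p11_coef.
rewrite (coef_eqm (ltnSn n) (mex_series_eqm n)).
have pent : eqm ('X^(n.+1)) (euler_prod ('X ^+ 2) 0 n.+1)
                            (shanks_pent ('X ^+ 2 : {poly 'F_2}) n.+1).
  apply: (@eqm_exp_leq _ _ (2 * n.+2)); first by lia.
  by rewrite exprM; apply: euler_prod_eqm_pent.
rewrite (coef_eqm (ltnSn n) pent) shanks_pentE coefD coef1 coef_sum.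
have -> : (n == 0)%N = false.
  by apply/eqP => n0; apply: (nsq 1%N); rewrite n0.
rewrite add0r big1 // => i _; rewrite -signr_odd mulr_sign -!exprM.
have tri_i := tri_double i; have tri_iS := tri_double i.+1.
have pent_coef : (('X^(2 * (i.+1 * i.+1 + tri i)) +
                   'X^(2 * (i.+1 * i.+1 + tri i.+1)))
           : {poly 'F_2})`_n = 0.
  rewrite coefD !coefXn.
  (* With k = i + 1, n = k(3k-1) gives 12n + 1 = (6k-1)^2, and below n = k(3k+1) gives (6k+1)^2. *)
  have -> : (n == 2 * (i.+1 * i.+1 + tri i))%N = false.
    by apply/eqP => n_pent; apply: (nsq (6 * i + 5)%N); rewrite expnS expn1; lia.
  have -> : (n == 2 * (i.+1 * i.+1 + tri i.+1))%N = false.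
    by apply/eqP => n_pent; apply: (nsq (6 * i + 7)%N); rewrite expnS expn1; lia.
  by rewrite addr0.
by case: odd; rewrite ?coefN pent_coef ?oppr0.
Qed.

End Parity.

(** * The p-adic valuation argument *)

Theorem theorem3p3 (p : nat) (p_prime : prime p) (p_ge5 : 5 <= p)
    (p_mod12 : p <> 1 %[mod 12]) (k n : nat) (p_ndvd_n : ~~ (p %| n)) :
  p11 (p ^ (2 * k + 1) * n + (p ^ (2 * k + 2) - 1) %/ 12) = 0 %[mod 2].
Proof.
rewrite mod0n modn2; apply/eqP; rewrite eqb0; apply: p11_even_nonsquare => m.
rewrite mulnDr [12 * (_ %/ _)]mulnC divnK ?dvd12_primeX // -addnA.
rewrite subnK; last first.
  by rewrite expn_gt0 prime_gt0.
have -> : 12 * (p ^ (2 * k + 1) * n) + p ^ (2 * k + 2) =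
          p ^ (2 * k + 1) * (12 * n + p).
  by rewrite mulnDr mulnCA -expnSr addn1 addn2.
have p_coprime : ~~ (p %| 12 * n + p).
  rewrite dvdn_addl // Euclid_dvdM // negb_or p_ndvd_n andbT.
  rewrite (_ : 12 = 2 ^ 2 * 3) // Euclid_dvdM // Euclid_dvdX // !dvdn_prime2 //.
  by rewrite andbT negb_or; apply/andP; split; apply/eqP; lia.
(* The valuation is 2k + 1 on the left and even on the right. *)
move/(congr1 (fun x => odd (logn p x))).
have p_gt0 := prime_gt0 p_prime.
rewrite lognM ?expn_gt0 ?addn_gt0 ?p_gt0 ?orbT //.
rewrite pfactorK // lognX (_ : logn p (12 * n + p) = 0).
  by rewrite addn0 addn1 /= !oddM.
by rewrite lognE p_prime (negbTE p_coprime) andbF.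
Qed.
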